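(* Let $(R,\mathfrak{m})\subset(\widetilde R,\mathfrak{n})$ be an extension of local rings, where $R$ is a $1$-dimensional Cohen-Macaulay local ring with canonical module $\omega_R$, $\widetilde R$ is a discrete valuation ring which is a finite $R$-module and satisfies $\widetilde R\subseteq Q(R)$, and the inclusion map $R\to\widetilde R$ induces an isomorphism $R/\mathfrak{m}\to\widetilde R/\mathfrak{n}$. Let $I\subset R$ be an ideal. The following conditions are equivalent: (i) $\operatorname{tr}(I)=\mathcal{C}_{\widetilde R/R}$; (ii) $\operatorname{End}(I^{-1})=\widetilde R$; (iii) $I^{-1}\cong\widetilde R$ (as $R$-modules).
   Context: $Q(R)$ is the total ring of fractions of $R$; here $Q(R)=Q(\widetilde R)$. The conductor of the extension is $\mathcal{C}_{\widetilde R/R}=\{x\in R: x\widetilde R\subseteq R\}$, an ideal of both $R$ and $\widetilde R$. For an $R$-module $N$, the trace is the ideal $\operatorname{tr}(N)=\sum_{\varphi\in\operatorname{Hom}_R(N,R)}\varphi(N)$ of $R$. Ideal quotients are computed in $Q(R)$: $A:B=\{x\in Q(R): xB\subseteq A\}$, and $I^{-1}=R:I$. For a fractional ideal $J$ of $R$, the endomorphism ring $\operatorname{End}(J)=\operatorname{End}_R(J)$ is identified with the subring $J:J$ of $Q(R)$; the equality in (ii) is to be read in $Q(R)$ via this identification. *)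

(* Defs.v *)
From HB Require Import structures.
From mathcomp Require Import all_boot all_order all_algebra.
From mathcomp Require Import boolp classical_sets functions.

Set Implicit Arguments.
Unset Strict Implicit.
Unset Printing Implicit Defensive.

Import GRing.Theory.
Local Open Scope classical_set_scope.
Local Open Scope ring_scope.

Section Modules.
Variable R : comNzRingType.

Definition is_submodule (V : lmodType R) (N : set V) : Prop :=
  N 0 /\ forall (a : R) (u v : V), N u -> N v -> N (a *: u + v).

Definition finitely_generated (V : lmodType R) (N : set V) : Prop :=
  exists s : seq V,
    N = [set v | exists c : 'I_(size s) -> R, v = \sum_(i < size s) c i *: s`_i].

(* An R-module is given as a submodule N of some V; the values outside N of a
   map that is linear on N are irrelevant. *)
Definition linear_on (V W : lmodType R) (N : set V) (f : V -> W) : Prop :=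
  forall (a : R) (u v : V), N u -> N v -> f (a *: u + v) = a *: f u + f v.

Definition module_iso (V W : lmodType R) (N : set V) (N' : set W) : Prop :=
  exists f : V -> W, linear_on N f /\ set_bij N N' f.

(* The sum of the images phi(N), over all phi in Hom_R(N, R). *)
Definition trace (V : lmodType R) (N : set V) : set R :=
  [set r | exists (n : nat) (phi : 'I_n -> V -> R^o) (x : 'I_n -> V),
     (forall i, linear_on N (phi i) /\ N (x i)) /\
     r = \sum_(i < n) phi i (x i)].

Definition injective_module (E : lmodType R) : Prop :=
  forall (A B : lmodType R) (f : {linear A -> B}) (g : {linear A -> E}),
    injective f -> exists h : {linear B -> E}, forall x, h (f x) = g x.

Record injective_resolution (M : lmodType R) := InjectiveResolution {
  ires_obj :> nat -> lmodType R;
  ires_aug : {linear M -> ires_obj 0%N};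
  ires_d : forall i, {linear ires_obj i -> ires_obj i.+1};
  ires_injective : forall i, injective_module (ires_obj i);
  ires_aug_inj : injective ires_aug;
  ires_exact0 : forall x, ires_d 0%N x = 0 <-> exists y, x = ires_aug y;
  ires_exact : forall i x, ires_d i.+1 x = 0 <-> exists y, x = ires_d i y }.

Definition finite_injective_dimension (M : lmodType R) : Prop :=
  exists (E : injective_resolution M) (n : nat),
    forall i, (n < i)%N -> forall x : E i, x = 0.

Definition cocycle (M N : lmodType R) (E : injective_resolution M) (i : nat)
    (g : N -> E i) : Prop :=
  forall x, ires_d E i (g x) = 0.

Definition coboundary (M N : lmodType R) (E : injective_resolution M)
    (i : nat) : (N -> E i) -> Prop :=
  match i with
  | 0%N => fun g => forall x, g x = 0
  | j.+1 => fun g =>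
      exists h : {linear N -> E j}, forall x, g x = ires_d E j (h x)
  end.

End Modules.

Section Rings.
Variable A : comNzRingType.

Definition is_ideal (I : set A) : Prop := is_submodule (I : set A^o).

Definition prime_ideal (P : set A) : Prop :=
  [/\ is_ideal P, ~ P 1 & forall x y, P (x * y) -> P x \/ P y].

Definition maximal_ideal (m : set A) : Prop :=
  [/\ is_ideal m, ~ m 1 &
      forall J : set A, is_ideal J -> ~ J 1 -> m `<=` J -> J = m].

Definition local_ring (m : set A) : Prop :=
  maximal_ideal m /\ forall m' : set A, maximal_ideal m' -> m' = m.

Definition noetherian : Prop :=
  forall I : set A, is_ideal I -> finitely_generated (I : set A^o).

(* p 0 < p 1 < ... < p n; the values of p beyond n are irrelevant. *)
Definition prime_chain (n : nat) (p : nat -> set A) : Prop :=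
  (forall i, (i <= n)%N -> prime_ideal (p i)) /\
  (forall i, (i < n)%N -> p i `<` p i.+1).

Definition krull_dimension (d : nat) : Prop :=
  (exists p, prime_chain d p) /\ forall n p, prime_chain n p -> (n <= d)%N.

(* The submodule (s_0, ..., s_(n-1)) M of M. *)
Definition seq_mul (M : lmodType A) (s : seq A) : set M :=
  [set y | exists x : 'I_(size s) -> M, y = \sum_(i < size s) s`_i *: x i].

Definition regular_sequence (M : lmodType A) (s : seq A) : Prop :=
  (forall i, (i < size s)%N -> forall y : M,
     seq_mul (take i s) (s`_i *: y) -> seq_mul (take i s) y) /\
  exists y : M, ~ seq_mul s y.

Definition depth (m : set A) (M : lmodType A) (t : nat) : Prop :=
  (exists s : seq A,
     [/\ size s = t, {in s, forall a, m a} & regular_sequence M s]) /\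
  forall s : seq A, {in s, forall a, m a} -> regular_sequence M s ->
    (size s <= t)%N.

Definition cohen_macaulay_local (m : set A) : Prop :=
  [/\ noetherian, local_ring m & exists d, krull_dimension d /\ depth m A^o d].

Definition maximal_cohen_macaulay (m : set A) (M : lmodType A) : Prop :=
  finitely_generated [set: M] /\ exists d, krull_dimension d /\ depth m M d.

(* dim_k Ext^i(k, M) = r for k = A/m, where Ext is the cohomology of Hom(k, E)
   for an injective resolution E of M.  The module k is given up to isomorphism
   by a surjection from A with kernel m; f is a family of cocycles whose
   classes form a k-basis of Ext^i(k, M). *)
Definition ext_residue_dim (m : set A) (M : lmodType A) (i r : nat) : Prop :=
  exists (k : lmodType A) (pi : {linear A^o -> k})
         (E : injective_resolution M) (f : 'I_r -> {linear k -> E i}),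
    [/\ (forall y, exists a, pi a = y) /\ (forall a, pi a = 0 <-> m a),
        forall j, cocycle (f j),
        forall g : {linear k -> E i}, cocycle g ->
          exists c : 'I_r -> A, coboundary (fun x => g x - \sum_j c j *: f j x)
      & forall c : 'I_r -> A, coboundary (fun x => \sum_j c j *: f j x) ->
          forall j, m (c j)].

Definition module_type (m : set A) (M : lmodType A) (r : nat) : Prop :=
  exists t, depth m M t /\ ext_residue_dim m M t r.

Definition canonical_module (m : set A) (W : lmodType A) : Prop :=
  [/\ maximal_cohen_macaulay m W, module_type m W 1
    & finite_injective_dimension W].

(* A local principal ideal domain that is not a field. *)
Definition discrete_valuation_ring (n : set A) : Prop :=
  [/\ forall x y : A, x * y = 0 -> x = 0 \/ y = 0,
      local_ring n,
      exists x, n x /\ x <> 0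
    & forall I : set A, is_ideal I ->
        exists a, I = [set x | exists b, x = b * a]].

End Rings.

(* A ring B containing an image of R is an R-algebra; the structure map is
   r |-> r%:A. *)
Section Extensions.
Variable R : comNzRingType.

(* R/m -> B/n is well defined and injective, resp. surjective. *)
Definition residue_iso (B : comAlgType R) (m : set R) (n : set B) : Prop :=
  (forall r : R, n r%:A <-> m r) /\
  (forall y : B, exists r : R, n (y - r%:A)).

(* Q is the localization of R at its nonzerodivisors. *)
Definition total_ring_of_fractions (Q : comAlgType R) : Prop :=
  [/\ injective (in_alg Q),
      forall s : R, GRing.lreg s -> exists q : Q, s%:A * q = 1
    & forall q : Q, exists a s : R, GRing.lreg s /\ s%:A * q = a%:A].

Definition conductor (B : comAlgType R) : set R :=
  [set x | forall y : B, exists r : R, x%:A * y = r%:A].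

Variable Q : comAlgType R.

Definition ideal_quotient (J K : set Q) : set Q :=
  [set x | forall y, K y -> J (x * y)].

Definition ideal_inverse (I : set R) : set Q :=
  ideal_quotient (range (in_alg Q)) (in_alg Q @` I).

(* End_R(J), identified with a subring of Q. *)
Definition endomorphism_ring (J : set Q) : set Q := ideal_quotient J J.

End Extensions.
Arguments ideal_inverse {R} Q I.
Arguments conductor {R} B.
Arguments krull_dimension : clear implicits.

(* Main.v *)
Require Import Defs.
From HB Require Import structures.
From mathcomp Require Import all_boot all_order all_algebra.
From mathcomp Require Import boolp classical_sets functions.
From mathcomp Require Import ring.

Set Implicit Arguments.
Unset Strict Implicit.
Unset Printing Implicit Defensive.

Import GRing.Theory.
Local Open Scope classical_set_scope.
Local Open Scope ring_scope.

(** Only three properties of the discrete valuation ring Rt matter: it is a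
    principal ideal domain, it is finite over R, and it is not a field.  Then Q
    is a field, and an Rt-submodule of Q that some nonzero element multiplies
    into Rt is principal.  For I <> 0, tr(I) = I I^-1, hence
    R : tr(I) = I^-1 : I^-1.  The conductor C = R : Rt is nonzero and of the form
    c Rt, so R : C = c^-1 (R : Rt) = Rt; this gives (i) => (ii).  If
    I^-1 : I^-1 = Rt, then tr(I) = d Rt is contained in C, and C / d is contained
    in R : tr(I) = Rt, so C = tr(I).  Finally (ii) says that I^-1 is a nonzero
    Rt-submodule of Q, so I^-1 = e Rt; conversely every R-linear map from I^-1
    to Rt is multiplication by an element of Q.  For I = 0 one has I^-1 = Q and
    all three conditions fail. *)

(** * Maps that are linear on a submodule only *)

Section LinearOn.
Variables (R : comNzRingType) (V W : lmodType R) (N : set V) (f : V -> W).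
Hypotheses (N_sub : is_submodule N) (f_lin : linear_on N f).

Lemma submoduleD u v : N u -> N v -> N (u + v).
Proof. by move=> Nu Nv; rewrite -[u]scale1r; apply: N_sub.2. Qed.

Lemma submoduleZ a u : N u -> N (a *: u).
Proof. by move=> Nu; rewrite -[_ *: _]addr0; apply: N_sub.2 => //; apply: N_sub.1. Qed.

Lemma linear_on0 : f 0 = 0.
Proof.
have := f_lin 1 N_sub.1 N_sub.1; rewrite !scale1r addr0 => f0.
by apply: (addrI (f 0)); rewrite addr0.
Qed.

Lemma linear_onZ a u : N u -> f (a *: u) = a *: f u.
Proof.
by move=> Nu; rewrite -[a *: u]addr0 f_lin ?linear_on0 ?addr0 //; apply: N_sub.1.
Qed.

End LinearOn.

Lemma ideal_mull (A : comNzRingType) (J : set A) (a x : A) :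
  is_ideal J -> J x -> J (a * x).
Proof. by move=> J_id Jx; apply: (@submoduleZ _ _ _ J_id). Qed.

Lemma ideal_neq0 (A : comNzRingType) (J : set A) :
  is_ideal J -> J <> [set 0] -> exists2 a, J a & a <> 0.
Proof.
move=> J_id J0; apply: contrapT => na; apply: J0.
apply/seteqP; split=> [x Jx|_ ->]; last exact: J_id.1.
by apply: contrapT => x0; apply: na; exists x.
Qed.

Lemma algM (R : nzRingType) (B : algType R) (a b : R) :
  (a * b)%:A = a%:A * b%:A :> B.
Proof. exact: (rmorphM (in_alg B)). Qed.

(** * Inverses and traces of ideals in the fraction field of a domain *)

Section FractionField.
Variables (R : comNzRingType) (Q : comAlgType R).
Hypothesis R_dom : forall a b : R, a * b = 0 -> a = 0 \/ b = 0.
Hypothesis Q_frac : total_ring_of_fractions Q.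

Let inj_in_alg : injective (in_alg Q). Proof. by case: Q_frac. Qed.

Lemma in_alg_neq0 (a : R) : a <> 0 -> a%:A <> 0 :> Q.
Proof. by move=> a0 aA; apply/a0/inj_in_alg; rewrite /= scale0r. Qed.

Lemma domain_lreg (a : R) : a <> 0 -> GRing.lreg a.
Proof.
move=> a0 x y /= xy; apply/subr0_eq.
by case: (@R_dom a (x - y)) => //; rewrite mulrBr xy subrr.
Qed.

(** If [q = a / s] is nonzero, then so is [a], which is therefore regular in the domain [R]; the
    inverse is [s / a]. *)
Lemma fractions_inv (q : Q) : q <> 0 -> exists u, q * u = 1.
Proof.
case: Q_frac => _ reg_unit frac q0; have [a [s [reg_s sq]]] := frac q.
have [u su] := reg_unit s reg_s.
have a0 : a <> 0.
  move=> a0; apply: q0; rewrite -[q]mul1r -su mulrAC sq a0.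
  by rewrite scale0r mul0r.
have [v av] := reg_unit a (domain_lreg a0).
by exists (s%:A * v); rewrite mulrCA mulrA sq.
Qed.

Lemma fractions_mulI (q : Q) : q <> 0 -> injective ( *%R q).
Proof.
move=> /fractions_inv[u qu] x y /= xy.
by rewrite -[x]mul1r -[y]mul1r -qu mulrC mulrA [x * q]mulrC xy; ring.
Qed.

Variable I : set R.
Hypothesis I_ideal : is_ideal I.

Lemma ideal_inverseP (J : set R) (q : Q) :
  ideal_inverse Q J q <-> forall x, J x -> exists r : R, q * x%:A = r%:A.
Proof.
split=> [qJ x Jx|qJ _ [x Jx <-]].
  by have [r _ <-] := qJ x%:A (imageP _ Jx); exists r.
by have [r qx] := qJ x Jx; exists r.
Qed.

Lemma ideal_inverse_submodule : is_submodule (ideal_inverse Q I).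
Proof.
split=> [|a u v /ideal_inverseP uI /ideal_inverseP vI]; apply/ideal_inverseP => x Ix.
  by exists 0; rewrite mul0r scale0r.
have [r ur] := uI x Ix; have [s vs] := vI x Ix.
by exists (a * r + s); rewrite mulrDl -scalerAl ur vs scalerDl scalerA.
Qed.

Lemma ideal_inverse1 : ideal_inverse Q I 1.
Proof. by apply/ideal_inverseP => x _; exists x; rewrite mul1r. Qed.

(** Multiplication by [q] is itself a linear map from [I] to [R]. This is the inclusion of [I I^-1]
    in [tr(I)]. *)
Lemma mul_ideal_inverse (q : Q) (x : R) :
  ideal_inverse Q I q -> I x ->
  exists2 r : R, trace (I : set R^o) r & q * x%:A = r%:A.
Proof.
move=> /ideal_inverseP qI Ix.
(* Multiplication by [q] leaves [R] outside [I]; there [phi] gets an arbitrary value. *)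
have [phi phiE] : {phi : R -> R & forall x, I x -> q * x%:A = (phi x)%:A}.
  suff /choice[phi ?] : forall x, exists r : R, I x -> q * x%:A = r%:A by exists phi.
  move=> y; have [/qI[r ?]|nIy] := pselect (I y); first by exists r.
  by exists 0 => /nIy.
exists (phi x); last exact: phiE.
exists 1%N, (fun=> phi), (fun=> x); split; last by rewrite big_ord1.
move=> _; split=> // a u v Iu Iv; apply: inj_in_alg => /=.
rewrite -phiE; last exact: I_ideal.2.
by rewrite !scalerDl -!scalerA mulrDr -scalerAr !phiE.
Qed.

(** For a nonzero [a] in [I], the identity [x phi(a) = phi(x a) = a phi(x)] shows that [phi] is
    multiplication by [phi(a) / a]. Hence [tr(I)] lies in [I I^-1]. *)
Lemma ideal_map_mul (phi : R -> R^o) : I <> [set 0] ->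
  linear_on (I : set R^o) phi ->
  exists2 q : Q, ideal_inverse Q I q & forall x, I x -> q * x%:A = (phi x)%:A.
Proof.
move=> I0 phi_lin.
have [a Ia a0] := ideal_neq0 I_ideal I0.
have [u au] := fractions_inv (in_alg_neq0 a0).
have qE x : I x -> u * (phi a)%:A * x%:A = (phi x)%:A.
  move=> Ix; have phiZ := linear_onZ I_ideal phi_lin.
  have xa : x * phi a = a * phi x :> R.
    by rewrite -[LHS]phiZ // -[RHS]phiZ //= [in LHS]/GRing.scale /= mulrC.
  by rewrite -mulrA -algM [phi a * x]mulrC xa algM mulrA [u * _]mulrC au mul1r.
by exists (u * (phi a)%:A) => //; apply/ideal_inverseP => x Ix; exists (phi x); apply: qE.
Qed.

(** An induction principle: the products [q y] generate [tr(I)] additively. It serves with [K] equal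
    to [R] and to [tr(I)]. *)
Lemma mul_trace (K : set Q) (x : Q) : I <> [set 0] ->
    K 0 -> (forall u v, K u -> K v -> K (u + v)) ->
    (forall q y, ideal_inverse Q I q -> I y -> K (x * (q * y%:A))) ->
  forall r, trace (I : set R^o) r -> K (x * r%:A).
Proof.
move=> I0 K0 KD Kx _ [k [phi [y [phi_lin ->]]]].
rewrite -[(\sum_i _)%:A]/(in_alg Q _) rmorph_sum mulr_sumr.
apply: big_ind => // i _ /=; have [lin_i Iy] := phi_lin i.
by have [q qI qE] := ideal_map_mul I0 lin_i; rewrite -qE //; apply: Kx.
Qed.

(** This is [R : (I I^-1) = (R : I) : I^-1]. *)
Lemma ideal_quotient_trace : I <> [set 0] ->
  ideal_inverse Q (trace (I : set R^o)) = endomorphism_ring (ideal_inverse Q I).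
Proof.
move=> I0; apply/seteqP; split=> x xP.
  move=> q qI; apply/ideal_inverseP => y Iy.
  have [r tr_r qy] := mul_ideal_inverse qI Iy.
  by rewrite -mulrA qy; apply: ((ideal_inverseP _ x).1 xP).
move=> _ [r tr_r <-].
apply: (mul_trace (K := range (in_alg Q))) tr_r => //.
- by exists 0; rewrite ?rmorph0.
- by move=> _ _ [u _ <-] [v _ <-]; exists (u + v); rewrite ?rmorphD.
move=> q y qI Iy; rewrite mulrA.
by apply: (xP q qI); exists y.
Qed.

End FractionField.

Lemma trace_ideal (R : comNzRingType) (V : lmodType R) (N : set V) :
  is_submodule N -> is_ideal (trace N).
Proof.
move=> N_sub; split.
  exists 0%N, (fun=> fun=> 0), (fun=> 0); split; first by case.
  by rewrite big_ord0.
move=> a _ _ [k [phi [x [phi_lin ->]]]] [l [psi [y [psi_lin ->]]]].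
exists (k + l)%N.
exists (fun i => match fintype.split i with inl i => phi i | inr i => psi i end).
exists (fun i => match fintype.split i with inl i => a *: x i | inr i => y i end).
split=> [i|].
  case: (fintype.split i) => j; last exact: psi_lin.
  by have [? ?] := phi_lin j; split=> //; apply: submoduleZ.
rewrite big_split_ord scaler_sumr; congr (_ + _); apply: eq_bigr => i _.
  rewrite (unsplitK (inl i)); have [? ?] := phi_lin i.
  by rewrite (linear_onZ N_sub).
by rewrite (unsplitK (inr i)).
Qed.

(** * Finite extensions inside [Q] that are principal ideal domains *)

Section PrincipalExtension.
Variables (R : comNzRingType) (Rt : comAlgType R) (Q : comAlgType R).
Variable iota : {lrmorphism Rt -> Q}.
Hypothesis Rt_dom : forall x y : Rt, x * y = 0 -> x = 0 \/ y = 0.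
Hypothesis Rt_pid : forall J : set Rt, is_ideal J ->
  exists a, J = [set x | exists b, x = b * a].
Hypothesis R_sub_Rt : injective (in_alg Rt).
Hypothesis Rt_fin : finitely_generated [set: Rt].
Hypothesis Q_frac : total_ring_of_fractions Q.
Hypothesis Rt_sub_Q : injective iota.

Lemma subdomain (a b : R) : a * b = 0 -> a = 0 \/ b = 0.
Proof.
move=> ab; have : a%:A * b%:A = 0 :> Rt by rewrite -algM ab scale0r.
by case/Rt_dom => c0; [left|right]; apply: R_sub_Rt; rewrite /= c0 scale0r.
Qed.

Let R_dom := subdomain.

Lemma iota_in_alg (r : R) : iota r%:A = r%:A.
Proof. by rewrite linearZ /= rmorph1. Qed.

Lemma iota_neq0 y : y <> 0 -> iota y <> 0.
Proof. by move=> y0 iy; apply/y0/Rt_sub_Q; rewrite iy rmorph0. Qed.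

Lemma conductorP (x : R) :
  conductor Rt x <-> forall y, exists r : R, x%:A * iota y = r%:A.
Proof.
split=> xC y; have [r xy] := xC y; exists r.
  by rewrite -!iota_in_alg -rmorphM xy.
by apply: Rt_sub_Q; rewrite rmorphM /= !iota_in_alg.
Qed.

(** A common denominator of finitely many generators of [Rt] lies in the conductor. *)
Lemma conductor_neq0 : exists2 d, conductor Rt d & d <> 0.
Proof.
have [s s_gen] := Rt_fin.
have [d d0 dP] : exists2 d : R, d <> 0 &
    forall i, (i < size s)%N -> exists r : R, d%:A * s`_i = r%:A.
  elim: (s) => [|y l [d d0 dP]].
    by exists 1 => //; apply/eqP; rewrite oner_eq0.
  have [_ _ frac] := Q_frac; have [a [e [reg_e ey]]] := frac (iota y).
  have {}ey : e%:A * y = a%:A by apply: Rt_sub_Q; rewrite rmorphM /= !iota_in_alg.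
  (* The denominator [e] of the new generator joins the product [d] of the earlier ones. *)
  exists (d * e) => [/R_dom[//|e0]|].
    by have /eqP := reg_e 1 0 ltac:(by rewrite e0 !mul0r); rewrite oner_eq0.
  case=> [_|i /dP[r dr]] /=.
    by exists (d * a); rewrite !algM -mulrA ey.
  by exists (e * r); rewrite !algM mulrAC dr mulrC.
exists d => // y.
have [c ->] : [set v | exists c : 'I_(size s) -> R, v = \sum_i c i *: s`_i] y.
  by rewrite -s_gen.
have /choice[r dr] : forall i : 'I_(size s), exists r : R, d%:A * s`_i = r%:A.
  by move=> i; apply: dP.
exists (\sum_i c i * r i).
rewrite mulr_sumr scaler_suml; apply: eq_bigr => i _.
by rewrite -scalerAr dr scalerA.
Qed.

Lemma ideal_inverse_set0 : ideal_inverse Q [set 0] = setT.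
Proof.
apply/seteqP; split=> // q _; apply/ideal_inverseP => _ ->.
by exists 0; rewrite scale0r mulr0.
Qed.

(** Such a [K] is the image of an ideal of [Rt], and that ideal is principal. *)
Lemma stable_principal (K : set Q) : K 0 ->
    (forall u v, K u -> K v -> K (u + v)) ->
    (forall y u, K u -> K (iota y * u)) ->
    K `<=` range iota ->
  exists d, K = [set u | exists y, u = iota y * iota d].
Proof.
move=> K0 KD KM KT; have [|d dE] := @Rt_pid (iota @^-1` K).
  split; first by rewrite /preimage /= rmorph0.
  by move=> a u v /= Ku Kv; rewrite rmorphD; apply: KD => //; rewrite rmorphM; apply: KM.
exists d; apply/seteqP; split=> [u Ku|_ [y ->]].
  have [y _ yu] := KT u Ku; have : (iota @^-1` K) y by rewrite /preimage /= yu.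
  by rewrite dE -yu => -[b ->]; exists b; rewrite rmorphM.
by apply: KM; have : (iota @^-1` K) d by rewrite dE; exists 1; rewrite mul1r.
Qed.

Lemma conductor_inverse : ideal_inverse Q (conductor Rt) = range iota.
Proof.
have [||||c cE] := @stable_principal (in_alg Q @` conductor Rt).
- exists 0; last by rewrite rmorph0.
  by move=> y; exists 0; rewrite scale0r mul0r.
- move=> _ _ [a aC <-] [b bC <-]; exists (a + b); last by rewrite rmorphD.
  move=> y; have [r ar] := aC y; have [s bs] := bC y.
  by exists (r + s); rewrite !scalerDl mulrDl ar bs.
- move=> y _ [a aC <-]; have [r ar] := aC y; exists r.
    by move=> z; have [s as_] := aC (y * z); exists s; rewrite -ar -mulrA.
  by rewrite /= -!iota_in_alg -ar rmorphM mulrC.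
- by move=> _ [a _ <-]; exists a%:A; rewrite ?iota_in_alg.
have c0 : c <> 0.
  have [d dC d0] := conductor_neq0 => c0.
  have : (in_alg Q @` conductor Rt) d%:A by exists d.
  by rewrite cE c0 rmorph0 => -[y]; rewrite mulr0; apply: in_alg_neq0.
have cC y : (in_alg Q @` conductor Rt) (iota y * iota c) by rewrite cE; exists y.
apply/seteqP; split=> [x xC|_ [y _ <-]]; last first.
  apply/ideal_inverseP => a /conductorP aC.
  by have [r ar] := aC y; exists r; rewrite mulrC.
have [d dC dc] := cC 1; rewrite rmorph1 mul1r /= in dc.
have [r _ /= rE] := xC _ (cC 1); rewrite rmorph1 mul1r in rE.
(* Here [r = x c]. As [x] maps every [y c] into [R], the element [r] is again in the conductor
   [c Rt]; cancelling [c] puts [x] in [Rt]. *)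
have rC : conductor Rt r.
  apply/conductorP => y; have [e _ /= eE] := xC _ (cC y); exists e.
  by rewrite eE rE; ring.
have : (in_alg Q @` conductor Rt) r%:A by exists r.
rewrite cE => -[y yE]; exists y => //.
apply: (fractions_mulI R_dom Q_frac (iota_neq0 c0)).
by rewrite mulrC -yE rE mulrC.
Qed.

(** * The equivalences for an ideal [I] *)

Variable I : set R.
Hypothesis I_ideal : is_ideal I.

Lemma endomorphism_ring_stable :
  endomorphism_ring (ideal_inverse Q I) = range iota ->
  forall y q, ideal_inverse Q I q -> ideal_inverse Q I (iota y * q).
Proof.
move=> endE y q qI; have : range iota (iota y) by exists y.
by rewrite -endE; apply.
Qed.

Lemma trace_conductor_endomorphism_ring : I <> [set 0] ->
  trace (I : set R^o) = conductor Rt ->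
  endomorphism_ring (ideal_inverse Q I) = range iota.
Proof.
by move=> I0 trE; rewrite -ideal_quotient_trace // trE conductor_inverse.
Qed.

Lemma endomorphism_ring_trace_conductor : I <> [set 0] ->
  endomorphism_ring (ideal_inverse Q I) = range iota ->
  trace (I : set R^o) = conductor Rt.
Proof.
move=> I0 endE; have tr_id := trace_ideal I_ideal.
pose K := in_alg Q @` trace (I : set R^o).
have K0 : K 0 by exists 0; rewrite ?rmorph0 //; apply: tr_id.1.
have KD u v : K u -> K v -> K (u + v).
  move=> [a a_tr <-] [b b_tr <-]; exists (a + b); last by rewrite rmorphD.
  exact: (@submoduleD _ _ _ tr_id).
(* [tr(I) = I I^-1] inherits stability under [Rt] from its factor [I^-1]. *)
have KM y u : K u -> K (iota y * u).
  move=> [r r_tr <-]; apply: (mul_trace (K := K) R_dom Q_frac I_ideal) r_tr => //.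
  move=> q x qI Ix; rewrite mulrA.
  have yqI := endomorphism_ring_stable endE y qI.
  by have [s s_tr ->] := mul_ideal_inverse Q_frac I_ideal yqI Ix; exists s.
have KT : K `<=` range iota.
  by move=> _ [r _ <-]; exists r%:A; rewrite ?iota_in_alg.
have [d KE] := stable_principal K0 KD KM KT.
have [injA _ _] := Q_frac.
have tr_K r : trace (I : set R^o) r <-> K r%:A.
  by split=> [r_tr|[s s_tr /injA <-]] //; exists r.
apply/seteqP; split=> [r /tr_K rK|r rC].
  by apply/conductorP => y; have [s _ sE] := KM y _ rK; exists s; rewrite mulrC -sE.
(* Since [1] lies in [I^-1], the ideal [I] is contained in [tr(I) = d Rt], so [d = 0] would force
   [I = 0]. *)
have d0 : iota d <> 0.
  move=> d0; apply: I0; apply/seteqP; split=> [x Ix|_ ->]; last exact: I_ideal.1.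
  have [s s_tr] := mul_ideal_inverse Q_frac I_ideal (@ideal_inverse1 _ Q I) Ix.
  rewrite mul1r => /injA ->; apply: injA; have /tr_K := s_tr.
  by rewrite KE d0 => -[y /= ->]; rewrite mulr0 scale0r.
have [u du] := fractions_inv R_dom Q_frac d0.
(* For [r] in the conductor, [r / d] maps [tr(I) = d Rt] into [r Rt], hence into [R]. *)
have : ideal_inverse Q (trace (I : set R^o)) (r%:A * u).
  apply/ideal_inverseP => s /tr_K; rewrite KE => -[y ->].
  move/conductorP: rC => /(_ y)[t tE]; exists t.
  by rewrite -tE -[RHS]mulr1 -du; ring.
rewrite ideal_quotient_trace // endE => -[y _ yE].
by apply/tr_K; rewrite KE; exists y; rewrite yE -mulrA [u * _]mulrC du mulr1.
Qed.

Lemma module_iso_endomorphism_ring :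
  module_iso (ideal_inverse Q I) [set: Rt] ->
  endomorphism_ring (ideal_inverse Q I) = range iota.
Proof.
move=> [f [f_lin [_ f_inj f_surj]]].
have J_sub := @ideal_inverse_submodule _ Q I.
have fZ := linear_onZ J_sub f_lin.
(* With [x = a / s] and [y = b / t], both [(b s) x] and [(a t) y] equal [a b]; applying [f] and
   cancelling the unit [s t] gives the claim. *)
have fM x y : ideal_inverse Q I x -> ideal_inverse Q I y ->
    iota (f x) * y = iota (f y) * x.
  move=> xJ yJ; have [_ reg_unit frac] := Q_frac.
  have [a [s [/reg_unit[u su] sx]]] := frac x.
  have [b [t [/reg_unit[v tv] ty]]] := frac y.
  have xy : (b * s) *: x = (a * t) *: y.
    rewrite -!scalerA -[s *: x]mulr_algl -[t *: y]mulr_algl sx ty.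
    by rewrite !scalerA mulrC.
  have := congr1 f xy; rewrite !fZ // => /(congr1 iota); rewrite !linearZ /=.
  rewrite -(mulr_algl (b * s)) -(mulr_algl (a * t)) !algM -sx -ty => fxy.
  have st1 : (s%:A * u) * (t%:A * v) = 1 by rewrite su tv mulr1.
  rewrite -[LHS]mul1r -[RHS]mul1r -st1.
  transitivity (u * v * (t%:A * y * s%:A * iota (f x))); first by ring.
  by rewrite fxy; ring.
(* The preimage [e] of [1] generates: taking [x = e] in [fM] gives [y = f(y) e], so
   [I^-1 = e Rt]. *)
have [e eJ fe] := f_surj 1 Logic.I.
have JE y : ideal_inverse Q I y -> y = iota (f y) * e.
  by move=> yJ; rewrite -fM // fe rmorph1 mul1r.
have e0 : e <> 0.
  move=> e0; have := linear_on0 J_sub f_lin; rewrite -e0 fe => /eqP.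
  by rewrite oner_eq0.
apply/seteqP; split=> [x xE|_ [y _ <-] q qJ].
  exists (f (x * e)) => //; apply: (fractions_mulI R_dom Q_frac e0).
  by rewrite mulrC -JE; [rewrite mulrC | apply: xE].
have [z zJ fz] := f_surj (y * f q) Logic.I.
by rewrite (JE q qJ) mulrA -rmorphM -fz -JE.
Qed.

Lemma endomorphism_ring_module_iso : I <> [set 0] ->
  endomorphism_ring (ideal_inverse Q I) = range iota ->
  module_iso (ideal_inverse Q I) [set: Rt].
Proof.
move=> I0 endE; have [a Ia a0] := ideal_neq0 I_ideal I0.
have J_sub := @ideal_inverse_submodule _ Q I.
(* [I^-1] need not lie in [Rt], but its multiple [a I^-1] lies in [R]; this multiple is [d Rt], with
   [d] nonzero. *)
pose K := [set u | exists2 q, ideal_inverse Q I q & u = q * a%:A].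
have KJ q : ideal_inverse Q I q -> K (q * a%:A) by exists q.
have [||||d KE] := @stable_principal K.
- by exists 0; rewrite ?mul0r //; apply: J_sub.1.
- move=> _ _ [u uJ ->] [v vJ ->]; exists (u + v); last by rewrite mulrDl.
  exact: (@submoduleD _ _ _ J_sub).
- move=> y _ [q qJ ->]; exists (iota y * q); last by rewrite mulrA.
  exact: endomorphism_ring_stable.
- move=> _ [q /ideal_inverseP/(_ a Ia)[r qa] ->]; exists r%:A => //.
  by rewrite iota_in_alg.
have aQ0 := in_alg_neq0 Q_frac a0.
have aI := fractions_mulI R_dom Q_frac aQ0.
have d0 : iota d <> 0.
  move=> d0; have := KJ 1 (@ideal_inverse1 _ Q I).
  by rewrite KE d0 mul1r => -[y]; rewrite mulr0.
have dI := fractions_mulI R_dom Q_frac d0.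
(* The isomorphism is [q |-> q a / d], extended arbitrarily outside [I^-1]. *)
have /choice[f fE] : forall q, exists y,
    ideal_inverse Q I q -> q * a%:A = iota y * iota d.
  move=> q; have [/KJ|nJq] := pselect (ideal_inverse Q I q); last by exists 0 => /nJq.
  by rewrite KE => -[y ?]; exists y.
exists f; split=> [b u v uJ vJ|].
  apply/Rt_sub_Q/dI; rewrite mulrC -fE; last exact: J_sub.2.
  by rewrite mulrDl -scalerAl !fE // linearP /= [RHS]mulrC mulrDl scalerAl.
split=> // [u v /set_mem uJ /set_mem vJ fuv|y _].
  by apply: aI; rewrite mulrC fE // fuv -fE // mulrC.
have : K (iota y * iota d) by rewrite KE; exists y.
move=> [q qJ qa]; exists q => //.
by apply/Rt_sub_Q/dI; rewrite mulrC -fE // -qa mulrC.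
Qed.

(** For [I = 0] the endomorphism ring is all of [Q], where [x] is invertible. *)
Lemma endomorphism_ring_neq_set0 (x : Rt) : x <> 0 -> (forall y, x * y <> 1) ->
  endomorphism_ring (ideal_inverse Q [set 0]) <> range iota.
Proof.
move=> x0 x_nu; rewrite ideal_inverse_set0 => endE.
have [u xu] := fractions_inv R_dom Q_frac (iota_neq0 x0).
have : range iota u by rewrite -endE.
case=> y _ yu; apply: (x_nu y); apply: Rt_sub_Q.
by rewrite rmorphM /= yu xu rmorph1.
Qed.

Lemma trace_set0_neq_conductor :
  trace ([set 0] : set R^o) <> conductor Rt.
Proof.
move=> trE; have [d] := conductor_neq0; rewrite -trE => -[k [phi [x [phi_lin ->]]]].
apply; apply: big1 => i _; have [lin_i ->] := phi_lin i.
apply: linear_on0 lin_i; split=> // a u v -> ->.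
by rewrite scaler0 addr0.
Qed.

End PrincipalExtension.

Theorem propositionA4
    (R : comNzRingType) (m : set R) (omega : lmodType R)
    (Rt : comAlgType R) (n : set Rt)
    (Q : comAlgType R) (iota : {lrmorphism Rt -> Q})
    (R_cm : cohen_macaulay_local m)
    (R_dim : krull_dimension R 1)
    (omega_can : canonical_module m omega)
    (Rt_dvr : discrete_valuation_ring n)
    (R_sub_Rt : injective (in_alg Rt))
    (Rt_fin : finitely_generated [set: Rt])
    (Q_frac : total_ring_of_fractions Q)
    (Rt_sub_Q : injective iota)
    (res_iso : residue_iso m n)
    (I : set R) (I_ideal : is_ideal I) :
  (trace (I : set R^o) = conductor Rt <->
     endomorphism_ring (ideal_inverse Q I) = range iota) /\
  (endomorphism_ring (ideal_inverse Q I) = range iota <->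
     module_iso (ideal_inverse Q I) [set: Rt]).
Proof.
case: Rt_dvr => Rt_dom [[n_ideal n1 _] _] [x [nx x0]] Rt_pid.
have x_nu y : x * y <> 1.
  by move=> xy; apply: n1; rewrite -xy mulrC; apply: ideal_mull.
(* Condition (ii) excludes [I = 0], as a nonzero element of the maximal ideal is no unit. *)
have endI0 : endomorphism_ring (ideal_inverse Q I) = range iota -> I <> [set 0].
  by move=> + IE; rewrite IE; apply: endomorphism_ring_neq_set0 x0 x_nu.
split; split=> hyp.
- apply: trace_conductor_endomorphism_ring => // IE.
  by move: hyp; rewrite IE; apply: trace_set0_neq_conductor Q_frac Rt_sub_Q.
- by apply: endomorphism_ring_trace_conductor (endI0 hyp) hyp.
- by apply: endomorphism_ring_module_iso (endI0 hyp) hyp.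
- exact: module_iso_endomorphism_ring.
Qed.
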